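(* Let $k$ be a field with $\operatorname{char} k \neq 2$. Let $L$ be a Lie algebra over $k$ with a basis $\{e_1,e_2,e_3\}$ such that $[e_1,e_2]=0$, $[e_1,e_3]=\alpha e_1+\beta e_2$, $[e_2,e_3]=\gamma e_1+\delta e_2$, where $\alpha,\beta,\gamma,\delta\in k$ and $\alpha\delta-\beta\gamma\neq 0$. Let $r\in L\otimes L$. Then $r$ is a solution of the CYBE in $L$ if and only if at least one of the following holds: (a) $r$ is strongly symmetric; or (b) there exist $p,q,s,u,x,y\in k$ such that $$r=p(e_1\otimes e_2)+q(e_2\otimes e_1)+s(e_1\otimes e_3)-s(e_3\otimes e_1)+u(e_2\otimes e_3)-u(e_3\otimes e_2)+x(e_1\otimes e_1)+y(e_2\otimes e_2)$$ and all of the following equalities hold: $$s(2\alpha x+\gamma(p+q))=0,\quad u(2\delta y+\beta(q+p))=0,\quad u(2\alpha x+\gamma(q+p))=0,\quad s(2\delta y+\beta(q+p))=0,$$ $$(\alpha-\delta)us+\gamma u^2-\beta s^2=0,$$ $$s(2\gamma y+2\beta x+(\alpha+\delta)(q+p))=0,\quad u(2\gamma y+2\beta x+(\alpha+\delta)(p+q))=0.$$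
   Context: CYBE: For a Lie algebra $L$ over $k$ and $r=\sum_i a_i\otimes b_i\in L\otimes L$, put $[r^{12},r^{13}]=\sum_{i,j}[a_i,a_j]\otimes b_i\otimes b_j$, $[r^{12},r^{23}]=\sum_{i,j}a_i\otimes[b_i,a_j]\otimes b_j$, $[r^{13},r^{23}]=\sum_{i,j}a_i\otimes a_j\otimes[b_i,b_j]$. The element $r$ is a solution of the (constant) classical Yang-Baxter equation (CYBE) in $L$ if $[r^{12},r^{13}]+[r^{12},r^{23}]+[r^{13},r^{23}]=0$ in $L\otimes L\otimes L$. Strongly symmetric: $r=\sum_{i,j=1}^3 k_{ij}(e_i\otimes e_j)$ with $k_{ij}\in k$ is strongly symmetric (with respect to the basis $e_1,e_2,e_3$) if $k_{ij}=k_{ji}$ and $k_{ij}k_{lm}=k_{il}k_{jm}$ for all $i,j,l,m\in\{1,2,3\}$. *)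

(* Defs.v *)
From HB Require Import structures.
From mathcomp Require Import all_boot all_algebra.

Set Implicit Arguments.
Unset Strict Implicit.
Unset Printing Implicit Defensive.

Import GRing.Theory.
Local Open Scope ring_scope.

(* A concrete model of the tensor product of finite-dimensional vector spaces:
   matrices indexed by the bases [vbasis {:U}] and [vbasis {:V}], with u ⊗ v the
   outer product of the coordinates of u and v. By [tensor_universal] below it
   has the universal property, so it does not depend on these bases up to
   canonical isomorphism. *)
Definition tensor (k : fieldType) (U V : vectType k) : vectType k :=
  'M[k]_(\dim {:U}, \dim {:V}).

Definition tens (k : fieldType) (U V : vectType k) (u : U) (v : V) :
    tensor U V :=
  \matrix_(i, j) (coord (vbasis {:U}) i u * coord (vbasis {:V}) j v).

Notation "u ⊗ v" := (tens u v) (at level 40, left associativity) : ring_scope.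

Section TensorTheory.
Variables (k : fieldType) (U V : vectType k).

Lemma tens_bilinear : bilinear_for *:%R *:%R (@tens k U V).
Proof.
split=> w a x y; apply/matrixP=> i j; rewrite !mxE linearP /=.
  by rewrite mulrDl mulrA.
by rewrite mulrDr mulrCA.
Qed.

HB.instance Definition _ := bilinear_isBilinear.Build k U V (tensor U V)
  *:%R *:%R (@tens k U V) tens_bilinear.

Let bU i := (vbasis {:U})`_i.
Let bV i := (vbasis {:V})`_i.

Let coord_vb (T : vectType k) (i j : 'I_(\dim {:T})) :
  coord (vbasis {:T}) i (vbasis {:T})`_j = (i == j)%:R.
Proof. by rewrite coord_free 1?eq_sym ?(basis_free (vbasisP _)). Qed.

Lemma tensor_basisE (r : tensor U V) :
  r = \sum_i \sum_j r i j *: (bU i ⊗ bV j).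
Proof.
rewrite {1}[r]matrix_sum_delta; apply: eq_bigr => i _; apply: eq_bigr => j _.
congr (_ *: _); apply/matrixP => i' j'.
by rewrite !mxE !coord_vb -natrM mulnb.
Qed.

Lemma tensor_decomp (r : tensor U V) :
  exists n (a : 'I_n -> U) (b : 'I_n -> V), r = \sum_i a i ⊗ b i.
Proof.
exists (\dim {:U}), bU, (fun i => \sum_j r i j *: bV j).
rewrite {1}[r]tensor_basisE; apply: eq_bigr => i _.
by rewrite linear_sumr; apply: eq_bigr => j _; rewrite linearZr_LR.
Qed.

Variable W : lmodType k.

Definition tensor_lift (f : U -> V -> W) (r : tensor U V) : W :=
  \sum_i \sum_j r i j *: f (bU i) (bV j).

Lemma tensor_lift_linear f : linear (tensor_lift f).
Proof.
move=> a r s; rewrite /tensor_lift scaler_sumr -big_split; apply: eq_bigr => i _.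
rewrite /= scaler_sumr -big_split; apply: eq_bigr => j _.
by rewrite !mxE scalerDl scalerA.
Qed.

HB.instance Definition _ f := GRing.isLinear.Build k (tensor U V) W *:%R
  (tensor_lift f) (tensor_lift_linear f).

Lemma tensor_liftE (f : {bilinear U -> V -> W}) u v :
  tensor_lift f (u ⊗ v) = f u v.
Proof.
rewrite [in RHS](coord_vbasis (memvf u)) [in RHS](coord_vbasis (memvf v)).
rewrite linear_sumlz; apply: eq_bigr => i _.
rewrite linear_sumr; apply: eq_bigr => j _.
by rewrite linearZl_LR linearZr_LR /= scalerA mxE.
Qed.

Lemma tensor_universal (f : {bilinear U -> V -> W}) :
  exists2 g : {linear tensor U V -> W}, (forall u v, g (u ⊗ v) = f u v) &
    forall g' : {linear tensor U V -> W},
      (forall u v, g' (u ⊗ v) = f u v) -> g' =1 g.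
Proof.
exists (tensor_lift f); first exact: tensor_liftE.
move=> g' g'E r; rewrite [r]tensor_basisE !linear_sum; apply: eq_bigr => i _.
rewrite !linear_sum; apply: eq_bigr => j _.
by rewrite !linearZ /= g'E tensor_liftE.
Qed.

Lemma tensor_sum_eq (f : U -> V -> W) n m (a : 'I_n -> U) b
    (c : 'I_m -> U) d :
  bilinear_for *:%R *:%R f ->
  \sum_i a i ⊗ b i = \sum_j c j ⊗ d j ->
  \sum_i f (a i) (b i) = \sum_j f (c j) (d j).
Proof.
move=> f_bil e.
pose F : {bilinear U -> V -> W} := HB.pack f
  (bilinear_isBilinear.Build k U V W *:%R *:%R f f_bil).
have FE u v : f u v = tensor_lift F (u ⊗ v) by rewrite tensor_liftE.
under eq_bigr do rewrite FE; under [RHS]eq_bigr do rewrite FE.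
by rewrite -!linear_sum e.
Qed.

End TensorTheory.

Definition is_lie_bracket (k : fieldType) (L : lmodType k)
    (br : {bilinear L -> L -> L}) : Prop :=
  (forall x, br x x = 0) /\
  (forall x y z, br x (br y z) + br y (br z x) + br z (br x y) = 0).

Section YangBaxter.
Variables (k : fieldType) (L : vectType k) (br : {bilinear L -> L -> L}).

(* L ⊗ L ⊗ L is modelled as L ⊗ (L ⊗ L). *)
Definition CYBE_lhs n (a b : 'I_n -> L) : tensor L (tensor L L) :=
    \sum_i \sum_j br (a i) (a j) ⊗ (b i ⊗ b j)
  + \sum_i \sum_j a i ⊗ (br (b i) (a j) ⊗ b j)
  + \sum_i \sum_j a i ⊗ (a j ⊗ br (b i) (b j)).

(* The left-hand side depends only on r, not on how it is written as a sum of
   pure tensors: see [CYBE_solutionP]. *)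
Definition CYBE_solution (r : tensor L L) : Prop :=
  forall n (a b : 'I_n -> L), r = \sum_i a i ⊗ b i -> CYBE_lhs a b = 0.

Let quad (x y z t : L) : tensor L (tensor L L) :=
  br x z ⊗ (y ⊗ t) + x ⊗ (br y z ⊗ t) + x ⊗ (z ⊗ br y t).

Let CYBE_lhs_quad n (a b : 'I_n -> L) :
  CYBE_lhs a b = \sum_i \sum_j quad (a i) (b i) (a j) (b j).
Proof.
rewrite /CYBE_lhs -!big_split; apply: eq_bigr => i _ /=.
by rewrite -!big_split; apply: eq_bigr.
Qed.

Let sumACA (V : zmodType) (x y z x' y' z' : V) :
  (x + x') + (y + y') + (z + z') = (x + y + z) + (x' + y' + z').
Proof. by rewrite (addrACA x x' y) (addrACA (x + y)). Qed.

Lemma CYBE_lhs_indep n m (a b : 'I_n -> L) (c d : 'I_m -> L) :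
  \sum_i a i ⊗ b i = \sum_j c j ⊗ d j -> CYBE_lhs a b = CYBE_lhs c d.
Proof.
move=> e; rewrite !CYBE_lhs_quad.
transitivity (\sum_i \sum_j quad (a i) (b i) (c j) (d j)).
  apply: eq_bigr => i _; apply: tensor_sum_eq e.
  by split=> x t y z; rewrite /applyr /quad;
    rewrite !(linearPl, linearPr) /= !scalerDr sumACA.
apply: (tensor_sum_eq (f := fun x y => \sum_j quad x y (c j) (d j))) e.
split=> x t y z; rewrite /applyr /= scaler_sumr -big_split; apply: eq_bigr => j _;
  by rewrite /quad !(linearPl, linearPr) /= !scalerDr sumACA.
Qed.

Lemma CYBE_solutionP (r : tensor L L) : CYBE_solution r <->
  exists n (a b : 'I_n -> L), r = \sum_i a i ⊗ b i /\ CYBE_lhs a b = 0.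
Proof.
split=> [sol | [n [a [b [-> ab0]]]] m c d e].
  by have [n [a [b e]]] := tensor_decomp r; exists n, a, b; split=> //; apply: sol.
by rewrite -(CYBE_lhs_indep e).
Qed.

End YangBaxter.

Definition strongly_symmetric (k : fieldType) (L : vectType k)
    (e : 3.-tuple L) (r : tensor L L) : Prop :=
  exists K : 'I_3 -> 'I_3 -> k,
    [/\ r = \sum_i \sum_j K i j *: (tnth e i ⊗ tnth e j),
        forall i j, K i j = K j i
      & forall i j l m, K i j * K l m = K i l * K j m].

(* Main.v *)
Require Import Defs.
From HB Require Import structures.
From mathcomp Require Import all_boot all_algebra.
From mathcomp Require Import ring.

Set Implicit Arguments.
Unset Strict Implicit.
Unset Printing Implicit Defensive.

Import GRing.Theory.
Local Open Scope ring_scope.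

(* Let V be the span of e1, e2, on which D = [-, e3] is invertible, and write
   r = w + v ⊗ e3 + e3 ⊗ v' + c (e3 ⊗ e3) with w in V ⊗ V and v, v' in V. Reading
   the CYBE componentwise, if c is not 0 then v' = v and, since 2 is invertible,
   c w = v ⊗ v, so r has rank one and is strongly symmetric. If c = 0, then
   v' = -v, and what remains is that v and D v are proportional and that the
   symmetric part of (D ⊗ 1 + 1 ⊗ D) w vanishes unless v = 0: these are the
   equations of (b). Conversely, every symmetric r of rank one solves the CYBE. *)

(** * Tensors relative to arbitrary free families and bases *)

(** The bilinear map sending [u], [v] to [coord X i u *: v] induces a linear map on the tensor
    product, and that map sends the sum to [y i]. *)
Lemma tens_free (k : fieldType) (U V : vectType k) n (X : n.-tuple U)
    (y : 'I_n -> V) :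
  free X -> \sum_(i < n) X`_i ⊗ y i = 0 -> forall i, y i = 0.
Proof.
move=> freeX sum0 i.
have f_bil : bilinear_for *:%R *:%R (fun u (v : V) => coord X i u *: v).
  split=> w a u v; first by rewrite /applyr /= linearP /= scalerDl scalerA.
  by rewrite /= scalerDr !scalerA mulrC.
pose F : {bilinear U -> V -> V} := HB.pack (fun u (v : V) => coord X i u *: v)
  (bilinear_isBilinear.Build k U V V *:%R *:%R _ f_bil).
have := linear0 (tensor_lift F); rewrite -sum0 linear_sum /= => <-.
rewrite (bigD1 i) //= (tensor_liftE F) /= coord_free // eqxx scale1r.
rewrite big1 ?addr0 // => j ne_ji.
by rewrite (tensor_liftE F) /= coord_free // (negPf ne_ji) scale0r.
Qed.

(** [tensor_basisE] covers only the bases [vbasis]; for other bases, both factors of each pure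
    tensor are expanded. *)
Lemma tensor_coords (k : fieldType) (U V : vectType k) n m (X : n.-tuple U)
    (Y : m.-tuple V) (r : tensor U V) :
  basis_of fullv X -> basis_of fullv Y ->
  exists K : 'I_n -> 'I_m -> k,
    r = \sum_(i < n) \sum_(j < m) K i j *: (X`_i ⊗ Y`_j).
Proof.
move=> bX bY; have [N [a [b ->]]] := tensor_decomp r.
exists (fun i j => \sum_t coord X i (a t) * coord Y j (b t)).
under [RHS]eq_bigr => i _.
  under eq_bigr do rewrite scaler_suml.
  rewrite exchange_big; over.
rewrite exchange_big; apply: eq_bigr => t _ /=.
rewrite {1}(coord_basis bX (memvf (a t))) {1}(coord_basis bY (memvf (b t))).
rewrite linear_sumlz; apply: eq_bigr => i _.
rewrite linear_sumr; apply: eq_bigr => j _.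
by rewrite linearZl_LR linearZr_LR /= scalerA.
Qed.

(** * The CYBE in terms of structure constants *)

Section Coefficients.
Variables (k : fieldType) (L : vectType k) (br : {bilinear L -> L -> L}).
Variables (n : nat) (X : n.-tuple L) (c : 'I_n -> 'I_n -> 'I_n -> k).
Variable K : 'I_n -> 'I_n -> k.

(** With structure constants [c] and coordinates [K] of r, this is the coefficient at
    [X_a ⊗ (X_b ⊗ X_d)]; the sums come from [r12, r13], [r12, r23] and [r13, r23] in this order. *)
Definition CYBE_coef (a b d : 'I_n) : k :=
  \sum_i \sum_j c i j a * (K i b * K j d)
  + \sum_i \sum_j c i j b * (K a i * K j d)
  + \sum_i \sum_j c i j d * (K a i * K b j).

Hypothesis brE : forall i j : 'I_n, br X`_i X`_j = \sum_(l < n) c i j l *: X`_l.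

(** Normal forms given by coefficient functions; the local lemmas below push sums, scalings, [⊗] and
    [br] into the coefficients. *)
Let comb (u : 'I_n -> k) : L := \sum_(i < n) u i *: X`_i.

Let tens2 (f : 'I_n -> 'I_n -> k) : tensor L L :=
  \sum_(b < n) X`_b ⊗ comb (f b).

Let tens3 (f : 'I_n -> 'I_n -> 'I_n -> k) : tensor L (tensor L L) :=
  \sum_(a < n) X`_a ⊗ tens2 (f a).

Let comb_sum (I : finType) (u : I -> 'I_n -> k) :
  \sum_t comb (u t) = comb (fun i => \sum_t u t i).
Proof.
by rewrite exchange_big; apply: eq_bigr => i _; rewrite scaler_suml.
Qed.

Let eq_comb u v : u =1 v -> comb u = comb v.
Proof. by move=> uv; apply: eq_bigr => i _; rewrite uv. Qed.

Let combZ a u : a *: comb u = comb (fun i => a * u i).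
Proof. by rewrite scaler_sumr; apply: eq_bigr => i _; rewrite scalerA. Qed.

Let tens2_sum (I : finType) (f : I -> 'I_n -> 'I_n -> k) :
  \sum_t tens2 (f t) = tens2 (fun b d => \sum_t f t b d).
Proof.
rewrite exchange_big; apply: eq_bigr => b _.
by rewrite -linear_sumr comb_sum.
Qed.

Let eq_tens2 f g : f =2 g -> tens2 f = tens2 g.
Proof. by move=> fg; apply: eq_bigr => b _; rewrite (eq_comb (fg b)). Qed.

Let tens2Z a f : a *: tens2 f = tens2 (fun b d => a * f b d).
Proof.
by rewrite scaler_sumr; apply: eq_bigr => b _; rewrite -linearZr_LR combZ.
Qed.

Let tens2_comb u v : comb u ⊗ comb v = tens2 (fun b d => u b * v d).
Proof.
rewrite linear_sumlz; apply: eq_bigr => b _.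
by rewrite linearZl_LR -linearZr_LR combZ.
Qed.

Let br_combl u (j : 'I_n) :
  br (comb u) X`_j = comb (fun l => \sum_i c i j l * u i).
Proof.
rewrite linear_sumlz -comb_sum; apply: eq_bigr => i _.
rewrite linearZl_LR brE combZ.
by apply: eq_comb => l; rewrite mulrC.
Qed.

Let br_comb u v :
  br (comb u) (comb v) = comb (fun l => \sum_i \sum_j c i j l * (u i * v j)).
Proof.
rewrite [in LHS]linear_sumr.
transitivity (comb (fun l => \sum_j \sum_i c i j l * (u i * v j))); last first.
  by apply: eq_comb => l; rewrite exchange_big.
rewrite -comb_sum; apply: eq_bigr => j _; rewrite linearZr_LR br_combl combZ.
apply: eq_comb => l; rewrite mulr_sumr; apply: eq_bigr => i _.
ring.
Qed.

(** The tensor is decomposed along the rows of [K]. The result is nested so that [tens_free] can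
    peel off one factor at a time. *)
Lemma CYBE_lhs_coef :
  CYBE_lhs br (fun i : 'I_n => X`_i) (fun i => \sum_(j < n) K i j *: X`_j) =
  \sum_(a < n) X`_a
    ⊗ (\sum_(b < n) X`_b ⊗ (\sum_(d < n) CYBE_coef a b d *: X`_d)).
Proof.
transitivity (
   tens3 (fun a b d => \sum_i \sum_j c i j a * (K i b * K j d))
 + tens3 (fun a b d => \sum_i \sum_j c i j b * (K a i * K j d))
 + tens3 (fun a b d => \sum_i \sum_j c i j d * (K a i * K b j))); last first.
  rewrite -!big_split; apply: eq_bigr => a _ /=; rewrite -!linearDr /=.
  rewrite -!big_split; congr (_ ⊗ _); apply: eq_bigr => b _ /=.
  rewrite -!linearDr /= -!big_split; congr (_ ⊗ _); apply: eq_bigr => d _.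
  by rewrite /= -!scalerDl.
congr (_ + _ + _).
(* Here the bracket lies in the outermost factor, so the sum over [a] that expands it has to move
   outside those over [i] and [j]. *)
- transitivity (\sum_i \sum_j \sum_(a < n) X`_a
      ⊗ tens2 (fun b d => c i j a * (K i b * K j d))).
    apply: eq_bigr => i _; apply: eq_bigr => j _.
    rewrite brE tens2_comb linear_sumlz; apply: eq_bigr => a _.
    by rewrite linearZl_LR -linearZr_LR tens2Z.
  under eq_bigr do rewrite exchange_big.
  rewrite exchange_big; apply: eq_bigr => a _ /=.
  under eq_bigr do rewrite -linear_sumr tens2_sum.
  by rewrite -linear_sumr tens2_sum.
- apply: eq_bigr => a _; rewrite -linear_sumr.
  under eq_bigr do rewrite br_combl tens2_comb.
  rewrite tens2_sum /=; congr (_ ⊗ _); apply: eq_tens2 => b d.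
  rewrite exchange_big; apply: eq_bigr => j _; rewrite mulr_suml.
  by apply: eq_bigr => i _; rewrite mulrA.
- apply: eq_bigr => a _; rewrite -linear_sumr; congr (_ ⊗ _).
  by apply: eq_bigr => b _; rewrite br_comb.
Qed.

(** [tens_free] removes the first two factors and freeness of [X] the third. Conversely, by
    [CYBE_solutionP] the decomposition by rows suffices. *)
Lemma CYBE_solution_coefP (r : tensor L L) :
  basis_of fullv X -> r = \sum_(i < n) \sum_(j < n) K i j *: (X`_i ⊗ X`_j) ->
  CYBE_solution br r <-> forall a b d, CYBE_coef a b d = 0.
Proof.
move=> bX rE; have fX := basis_free bX.
have {}rE : r = \sum_(i < n) X`_i ⊗ (\sum_(j < n) K i j *: X`_j).
  rewrite rE; apply: eq_bigr => i _; rewrite linear_sumr.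
  by apply: eq_bigr => j _; rewrite linearZr_LR.
split=> [/(_ n _ _ rE) | coef0].
  rewrite CYBE_lhs_coef => lhs0 a b d.
  exact: (elimT freeP fX (CYBE_coef a b) (tens_free fX (tens_free fX lhs0 a) b)).
apply/CYBE_solutionP; exists n; do 2!eexists; split; first exact: rE.
rewrite CYBE_lhs_coef big1 // => a _; rewrite big1 ?linear0r // => b _.
by rewrite big1 ?linear0r // => d _; rewrite coef0 scale0r.
Qed.
End Coefficients.

(** * Three indices, and skew-symmetry of alternating maps *)

Local Notation i1 := (@Ordinal 3 0 isT).
Local Notation i2 := (@Ordinal 3 1 isT).
Local Notation i3 := (@Ordinal 3 2 isT).

Lemma sum_ord3 (V : nmodType) (F : 'I_3 -> V) :
  \sum_i F i = F i1 + F i2 + F i3.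
Proof.
rewrite !big_ord_recl big_ord0 addr0 addrA.
by congr (F _ + F _ + F _); apply: val_inj.
Qed.

Lemma forall_ord3 (P : 'I_3 -> Prop) : P i1 -> P i2 -> P i3 -> forall i, P i.
Proof.
move=> P1 P2 P3 [[|[|[|//]]] lt_i3].
- by rewrite (_ : Ordinal _ = i1) //; apply: val_inj.
- by rewrite (_ : Ordinal _ = i2) //; apply: val_inj.
- by rewrite (_ : Ordinal _ = i3) //; apply: val_inj.
Qed.

Lemma alt_bilinear_skew (R : comNzRingType) (U V : lmodType R)
    (f : {bilinear U -> U -> V}) :
  (forall x, f x x = 0) -> forall x y, f y x = - f x y.
Proof.
move=> f_alt x y; apply/eqP; rewrite -addr_eq0; apply/eqP.
have := f_alt (x + y).
by rewrite linearDl !linearDr /= !f_alt add0r addr0 addrC.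
Qed.

(** * Coordinate equations for the semidirect product of V and [e3] *)

Section SemidirectProduct.
Variables (k : fieldType) (alpha beta gamma delta : k).

(* Row [i] holds the coordinates of [[e_i, e3]]. *)
Definition ad3 (i l : 'I_3) : k :=
  match val i, val l with
  | 0, 0 => alpha | 0, 1 => beta | 1, 0 => gamma | 1, 1 => delta | _, _ => 0
  end.

Definition struct3 (i j l : 'I_3) : k :=
  ad3 i l *+ (j == i3) - ad3 j l *+ (i == i3).

(** V is abelian, so one index of each double sum must be [i3]; its two possible positions give the
    two terms of each difference. *)
Lemma struct3_coefE (K : 'I_3 -> 'I_3 -> k) a b d :
  CYBE_coef struct3 K a b d =
  \sum_i (ad3 i a * (K i b * K i3 d - K i3 b * K i d)
        + ad3 i b * (K a i * K i3 d - K a i3 * K i d)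
        + ad3 i d * (K a i * K b i3 - K a i3 * K b i)).
Proof. by rewrite /CYBE_coef /struct3 !sum_ord3 /=; ring. Qed.

Hypothesis two_neq0 : 2 != 0 :> k.
Hypothesis det_neq0 : alpha * delta - beta * gamma != 0.

(** Cramer's rule on V; the coordinate at [i3] stays free because that row of [ad3] is zero. *)
Lemma ad3_inj (u : 'I_3 -> k) :
  (forall b, \sum_i ad3 i b * u i = 0) -> forall i, i != i3 -> u i = 0.
Proof.
move=> Du0; have := Du0 i1; have := Du0 i2.
rewrite !sum_ord3 /ad3 /= !mul0r !addr0 => E2 E1.
elim/forall_ord3 => // _; apply: (mulfI det_neq0); rewrite mulr0.
  transitivity (delta * (alpha * u i1 + gamma * u i2)
                - gamma * (beta * u i1 + delta * u i2)); first by ring.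
  by rewrite E1 E2 !mulr0 subrr.
transitivity (alpha * (beta * u i1 + delta * u i2)
              - beta * (alpha * u i1 + gamma * u i2)); first by ring.
by rewrite E1 E2 !mulr0 subrr.
Qed.

Section Solutions.
Variable K : 'I_3 -> 'I_3 -> k.

(* With [M = (K i3 i * K i3 j - K i3 i3 * K i j)], the coefficients at
   [e3 ⊗ V ⊗ V] and [V ⊗ e3 ⊗ V] say that [ad3 ⊗ 1 + 1 ⊗ ad3] and
   [ad3 ⊗ 1 - 1 ⊗ ad3] both kill [M]. *)
Lemma coef0_rank1 :
  (forall a b d, CYBE_coef struct3 K a b d = 0) -> K i3 i3 != 0 ->
  forall i j, K i j = K i3 i * K i3 j / K i3 i3.
Proof.
move=> K0 K33; have two0 (x : k) : 2 * x = 0 -> x = 0.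
  by move/eqP; rewrite mulf_eq0 (negPf two_neq0) => /eqP.
(* The coefficient at [e3 ⊗ V ⊗ e3] is [K i3 i3] times [ad3] applied to the last row minus the last
   column. *)
have sym i : K i i3 = K i3 i.
  have [-> // | ne_i3] := eqVneq i i3.
  apply: (mulfI K33); apply/esym/eqP; rewrite -subr_eq0; apply/eqP.
  apply: (ad3_inj (u := fun i => K i3 i3 * K i3 i - K i3 i3 * K i i3)) ne_i3.
  move=> b; apply: etrans (K0 i3 b i3).
  by rewrite struct3_coefE !sum_ord3 /ad3 /=; ring.
have rank1 i j : K i3 i3 * K i j = K i3 i * K i3 j.
  have [-> // | ne_i3] := eqVneq i i3.
  apply/esym/eqP; rewrite -subr_eq0; apply/eqP.
  apply: (ad3_inj (u := fun i => K i3 i * K i3 j - K i3 i3 * K i j)) ne_i3 => b.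
  (* In the sum of the two coefficients [1 ⊗ ad3] cancels and [ad3 ⊗ 1] is doubled. *)
  apply: two0.
  transitivity (CYBE_coef struct3 K i3 b j + CYBE_coef struct3 K b i3 j).
    rewrite !struct3_coefE !sum_ord3 /ad3 /= (sym i1) (sym i2); ring.
  by rewrite !K0 addr0.
by move=> i j; rewrite -rank1 mulrAC divff // mul1r.
Qed.

Lemma coef0_skew :
  (forall a b d, CYBE_coef struct3 K a b d = 0) -> K i3 i3 = 0 ->
  forall i, K i3 i = - K i i3.
Proof.
move=> K0 K33.
(* The coefficients with exactly one [e3] give [v ⊗ ad3 z = 0 = ad3 z ⊗ v'],
   where [v = K _ i3] and [v' = K i3 _]; hence [z ⊗ z = 0]. *)
pose z i := K i i3 + K i3 i.
have z0l a i : K a i3 * z i = 0.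
  have [-> | ne_i3] := eqVneq i i3; first by rewrite /z K33 addr0 mulr0.
  apply: (ad3_inj (u := fun i => K a i3 * z i)) ne_i3 => b.
  transitivity (- CYBE_coef struct3 K a b i3 - CYBE_coef struct3 K a i3 b).
    rewrite !struct3_coefE !sum_ord3 /z /ad3 /= !K33; ring.
  by rewrite !K0 oppr0 addr0.
have z0r b i : K i3 b * z i = 0.
  have [-> | ne_i3] := eqVneq i i3; first by rewrite /z K33 addr0 mulr0.
  apply: (ad3_inj (u := fun i => K i3 b * z i)) ne_i3 => a.
  transitivity (CYBE_coef struct3 K i3 a b + CYBE_coef struct3 K a i3 b).
    rewrite !struct3_coefE !sum_ord3 /z /ad3 /= !K33; ring.
  by rewrite !K0 addr0.
move=> i; apply/eqP; rewrite -addr_eq0 addrC -[_ + _]/(z i).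
by rewrite -sqrf_eq0 expr2 {1}/z mulrDl z0l z0r addr0.
Qed.

(* The matrix of [(ad3 ⊗ 1 + 1 ⊗ ad3) r]. *)
Definition ad3_tens (a b : 'I_3) : k :=
  \sum_i (ad3 i a * K i b + ad3 i b * K a i).

(** Every product in [struct3_coefE] has a factor in the last row or column of [K], that is, up to
    sign, a coordinate of v = [K _ i3]. Collecting these leaves [ad3_tens] with v inserted in the
    middle, last and first factor. *)
Lemma coef_skewE a b d : (forall i, K i3 i = - K i i3) ->
  CYBE_coef struct3 K a b d =
  K b i3 * ad3_tens a d - K d i3 * ad3_tens a b - K a i3 * ad3_tens b d.
Proof.
by move=> skew; rewrite struct3_coefE /ad3_tens !sum_ord3 (skew b) (skew d); ring.
Qed.

(** Coefficients with all indices in V give the first condition. Those with one index [i3] are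
    trivial or give, up to sign, the second, which says that v and [ad3] v are proportional. The
    others vanish. *)
Lemma coef0_skewP : K i3 i3 = 0 -> (forall i, K i3 i = - K i i3) ->
  (forall a b d, CYBE_coef struct3 K a b d = 0) <->
  (forall d, d != i3 -> [/\ K d i3 * ad3_tens i1 i1 = 0,
                             K d i3 * ad3_tens i2 i2 = 0
                           & K d i3 * (ad3_tens i1 i2 + ad3_tens i2 i1) = 0])
  /\ K i2 i3 * ad3_tens i1 i3 = K i1 i3 * ad3_tens i2 i3.
Proof.
move=> K33 skew.
have T33 : ad3_tens i3 i3 = 0 by rewrite /ad3_tens sum_ord3 /ad3 /=; ring.
have T3 i : ad3_tens i3 i = - ad3_tens i i3.
  by rewrite /ad3_tens !sum_ord3 /ad3 /= (skew i1) (skew i2); ring.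
pose E a b d :=
  K b i3 * ad3_tens a d - K d i3 * ad3_tens a b - K a i3 * ad3_tens b d.
transitivity (forall a b d, E a b d = 0).
  by split=> E0 a b d; have := E0 a b d; rewrite coef_skewE.
rewrite {}/E; move: ad3_tens T33 T3 K33 => {skew} t t33 t3 v3.
split=> [E | [sym0 wedge0] a b d].
  have s11 : K i1 i3 * t i1 i1 = 0.
    by apply: oppr_inj; rewrite oppr0; apply: etrans (E i1 i1 i1); ring.
  have s22 : K i1 i3 * t i2 i2 = 0.
    by apply: oppr_inj; rewrite oppr0; apply: etrans (E i1 i2 i2); ring.
  have u11 : K i2 i3 * t i1 i1 = 0.
    by apply: oppr_inj; rewrite oppr0; apply: etrans (E i2 i1 i1); ring.
  have u22 : K i2 i3 * t i2 i2 = 0.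
    by apply: oppr_inj; rewrite oppr0; apply: etrans (E i2 i2 i2); ring.
  split; last first.
    apply/eqP; rewrite -subr_eq0; apply/eqP; apply: etrans (E i1 i2 i3).
    by rewrite v3; ring.
  (* Each of these coefficients is the negated goal plus a diagonal term, which [u11] or [s22]
     removes. *)
  elim/forall_ord3 => // _; split=> //; apply: oppr_inj; rewrite oppr0.
    by apply: etrans (E i1 i2 i1); rewrite u11; ring.
  by apply: etrans (E i2 i1 i2); rewrite s22; ring.
have [s11 s22 /eqP] := sym0 i1 isT; rewrite mulrDr addr_eq0 => /eqP s12.
have [u11 u22 /eqP] := sym0 i2 isT; rewrite mulrDr addr_eq0 => /eqP u12.
by move: a b d; do 3 elim/forall_ord3; rewrite ?t33 ?t3 ?v3 ?mulrN
  ?(s11, s22, s12, u11, u22, u12, wedge0); ring.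
Qed.
End Solutions.

Variables (L : vectType k) (br : {bilinear L -> L -> L}) (e1 e2 e3 : L).
Hypothesis br_alt : forall x, br x x = 0.
Hypotheses (h12 : br e1 e2 = 0) (h13 : br e1 e3 = alpha *: e1 + beta *: e2)
  (h23 : br e2 e3 = gamma *: e1 + delta *: e2).

Lemma br_struct3 (i j : 'I_3) : let X := [tuple e1; e2; e3] in
  br X`_i X`_j = \sum_(l < 3) struct3 i j l *: X`_l.
Proof.
rewrite /= sum_ord3 /=.
elim/forall_ord3: i; elim/forall_ord3: j => /=;
  rewrite /struct3 /ad3 /= ?mulr0n ?mulr1n ?subr0 ?sub0r ?subrr ?scale0r ?addr0.
all: rewrite ?(br_alt, h12, h13, h23) //.
all: by rewrite (alt_bilinear_skew br_alt) ?(h12, h13, h23) ?oppr0 // !scaleNr opprD.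
Qed.

Lemma struct3_solutionP (K : 'I_3 -> 'I_3 -> k) (r : tensor L L) :
  let X := [tuple e1; e2; e3] in basis_of {:L} X ->
  r = \sum_i \sum_j K i j *: (tnth X i ⊗ tnth X j) ->
  CYBE_solution br r <-> forall a b d, CYBE_coef struct3 K a b d = 0.
Proof.
move=> X bX rE; apply: (CYBE_solution_coefP (X := X)) => //.
  exact: br_struct3.
by rewrite rE; do 2!apply: eq_bigr => ? _; rewrite !(tnth_nth 0).
Qed.

End SemidirectProduct.

(** * Classification by the coefficient at [e3 ⊗ e3] *)

Theorem theorem2p1 (k : fieldType) (hk : 2%N \notin [pchar k])
    (L : vectType k) (br : {bilinear L -> L -> L}) (hL : is_lie_bracket br)
    (e1 e2 e3 : L) (he : basis_of {:L} [:: e1; e2; e3])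
    (alpha beta gamma delta : k)
    (h12 : br e1 e2 = 0)
    (h13 : br e1 e3 = alpha *: e1 + beta *: e2)
    (h23 : br e2 e3 = gamma *: e1 + delta *: e2)
    (hdet : alpha * delta - beta * gamma != 0)
    (r : tensor L L) :
  CYBE_solution br r <->
  strongly_symmetric [tuple e1; e2; e3] r \/
  exists p q s u x y : k,
    r = p *: (e1 ⊗ e2) + q *: (e2 ⊗ e1)
        + s *: (e1 ⊗ e3) - s *: (e3 ⊗ e1)
        + u *: (e2 ⊗ e3) - u *: (e3 ⊗ e2)
        + x *: (e1 ⊗ e1) + y *: (e2 ⊗ e2) /\
    [/\ s * (2 * alpha * x + gamma * (p + q)) = 0,
        u * (2 * delta * y + beta * (q + p)) = 0,
        u * (2 * alpha * x + gamma * (q + p)) = 0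
      & s * (2 * delta * y + beta * (q + p)) = 0] /\
    (alpha - delta) * u * s + gamma * u ^+ 2 - beta * s ^+ 2 = 0 /\
    s * (2 * gamma * y + 2 * beta * x + (alpha + delta) * (q + p)) = 0 /\
    u * (2 * gamma * y + 2 * beta * x + (alpha + delta) * (p + q)) = 0.
Proof.
have two_neq0 : 2 != 0 :> k by move: hk; rewrite inE.
have solP K := struct3_solutionP (K := K) hL.1 h12 h13 h23 he.
split=> [sol | [[K [rE symK exchK]] | ]].
- have [K] := tensor_coords (X := [tuple e1; e2; e3]) (Y := [tuple e1; e2; e3])
    r he he.
  under eq_bigr do under eq_bigr do rewrite -!tnth_nth.
  move=> rE; have K0 := (solP _ K rE).1 sol.
  have [K33 | K33] := eqVneq (K i3 i3) 0; last first.
    have rank1 := coef0_rank1 two_neq0 hdet K0 K33.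
    left; exists K; split=> // [i j | i j l m].
      by rewrite (rank1 i j) (rank1 j i); ring.
    by rewrite (rank1 i j) (rank1 l m) (rank1 i l) (rank1 j m); ring.
  right; have skew := coef0_skew hdet K0 K33.
  have [sym0 wedge0] := (coef0_skewP _ _ _ _ K33 skew).1 K0.
  have [s11 s22 s12] := sym0 i1 isT; have [u11 u22 u12] := sym0 i2 isT.
  move: s11 s22 s12 u11 u22 u12 wedge0.
  rewrite /ad3_tens !sum_ord3 /ad3 /= => s11 s22 s12 u11 u22 u12 wedge0.
  exists (K i1 i2), (K i2 i1), (K i1 i3), (K i2 i3), (K i1 i1), (K i2 i2).
  split; last split; last split; last split.
  + rewrite rE !sum_ord3 /= (skew i1) (skew i2) K33.
    by apply/matrixP => a b; rewrite !mxE; ring.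
  + split; [apply: etrans s11 | apply: etrans u22
           | apply: etrans u11 | apply: etrans s22]; ring.
  (* Here [wedge0] reads [u * (alpha * s + gamma * u) = s * (beta * s + delta * u)]. *)
  + move/eqP: wedge0; rewrite -subr_eq0 => /eqP wedge0.
    by apply: etrans wedge0; ring.
  + by apply: etrans s12; ring.
  + by apply: etrans u12; ring.
(* Symmetry and the exchange rule make each difference in [struct3_coefE] vanish separately. *)
- apply/(solP _ K rE) => a b d; rewrite struct3_coefE big1 // => i _.
  rewrite (symK i b) (exchK b i i3 d) (symK b i3) (exchK a i i3 d).
  by rewrite (exchK a i i3 b) (symK i b); ring.
case=> p [q [s [u [x [y [rE [[s11 u22 u11 s22] [wedge0 [s12 u12]]]]]]]]].
(* The coordinates of r in (b), wildcards standing for [i3]: the corner is zero and the last row is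
   minus the last column, as [coef0_skewP] requires. *)
pose K (i j : 'I_3) : k := match val i, val j with
  | 0, 0 => x | 0, 1 => p | 0, _ => s
  | 1, 0 => q | 1, 1 => y | 1, _ => u
  | _, 0 => - s | _, 1 => - u | _, _ => 0 end.
apply/(solP _ K).
  rewrite rE !sum_ord3 /K /=.
  by apply/matrixP => a b; rewrite !mxE; ring.
apply/coef0_skewP => //; first by elim/forall_ord3; rewrite /K /= ?oppr0.
rewrite /ad3_tens !sum_ord3 /ad3 /K /=; split.
  elim/forall_ord3 => //= _; split;
    [apply: etrans s11 | apply: etrans s22 | apply: etrans s12
    |apply: etrans u11 | apply: etrans u22 | apply: etrans u12]; ring.
by apply/eqP; rewrite -subr_eq0; apply/eqP; apply: etrans wedge0; ring.
Qed.
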